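(* Let $(\Sigma,\partial)$ be a differential field whose field of constants $\mathbf{C}$ is algebraically closed and of characteristic zero. Let $P,Q\in\Sigma[\partial]\setminus\mathbf{C}[\partial]$ be commuting differential operators, both of positive order. Then the ideal $\mathrm{BC}(P,Q)$ is a prime ideal in $\mathbf{C}[\lambda,\mu]$.
   Context: $\Sigma[\partial]$ is the ring of differential operators with coefficients in $\Sigma$ ($\partial a=a\partial+\partial(a)$). The Burchnall–Chaundy ideal is $\mathrm{BC}(P,Q)=\{g\in\mathbf{C}[\lambda,\mu]\mid g(P,Q)=0\}$, the kernel of the ring homomorphism $\mathbf{C}[\lambda,\mu]\to\Sigma[\partial]$, $\lambda\mapsto P$, $\mu\mapsto Q$. *)

(* Defs.v *)
From HB Require Import structures.
From mathcomp Require Import all_boot all_order all_algebra.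
From mathcomp Require Import mpoly.

Set Implicit Arguments.
Unset Strict Implicit.
Unset Printing Implicit Defensive.

Import GRing.Theory.
Local Open Scope ring_scope.

HB.mixin Record hasDerivation (R : Type) of GRing.NzRing R := {
  der : R -> R;
  derD : {morph der : x y / x + y};
  derM : forall x y, der (x * y) = der x * y + x * der y
}.

#[short(type="diffFieldType")]
HB.structure Definition DiffField := {R of GRing.Field R & hasDerivation R}.

Section Derivation.
Variable K : diffFieldType.

Fact der_is_zmod_morphism : zmod_morphism (@der K).
Proof.
have der0 : der 0 = 0 :> K.
  by apply: (addrI (der 0)); rewrite -derD !addr0.
move=> x y; rewrite derD; congr (_ + _).
by apply: (addrI (der y)); rewrite -derD !subrr der0.
Qed.

HB.instance Definition _ :=
  GRing.isZmodMorphism.Build K K (@der K) der_is_zmod_morphism.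

Lemma der1 : der 1 = 0 :> K.
Proof.
by apply: (addrI (der 1)); rewrite addr0 -{3}[1]mulr1 derM mulr1 mul1r.
Qed.

Definition is_const : {pred K} := [pred c | der c == 0].

Fact is_const_divring_closed : GRing.divring_closed is_const.
Proof.
split=> [|x y|x y]; rewrite !inE ?der1 // => /eqP dx /eqP dy.
  by rewrite raddfB /= dx dy subrr.
have [->|y0] := eqVneq y 0; first by rewrite invr0 mulr0 raddf0.
have dVy : der y^-1 = 0.
  have /eqP := derM y y^-1.
  by rewrite divff // der1 dy mul0r add0r eq_sym mulf_eq0 (negPf y0) => /eqP.
by rewrite derM dx dVy mul0r mulr0 addr0.
Qed.

HB.instance Definition _ :=
  GRing.isDivringClosed.Build K is_const is_const_divring_closed.

End Derivation.

Record constants (K : diffFieldType) :=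
  Constant { const_val : K; _ : const_val \in @is_const K }.

HB.instance Definition _ (K : diffFieldType) :=
  [isSub for @const_val K].
HB.instance Definition _ (K : diffFieldType) :=
  [Choice of constants K by <:].
HB.instance Definition _ (K : diffFieldType) :=
  [SubChoice_isSubIntegralDomain of constants K by <:].
HB.instance Definition _ (K : diffFieldType) :=
  [SubIntegralDomain_isSubField of constants K by <:].

(* [DiffOp p] is the operator sum_i p`_i d^i, with coefficients on the left.
   It wraps {poly K} to keep the commutative product of {poly K} away. *)
Record diffop (K : diffFieldType) := DiffOp { coefs : {poly K} }.

HB.instance Definition _ (K : diffFieldType) := [isNew for @coefs K].
HB.instance Definition _ (K : diffFieldType) := [Choice of diffop K by <:].

Section DiffopRing.
Variable K : diffFieldType.
Implicit Types (p q r : {poly K}) (A B : diffop K).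

(* Coefficients of d o q, from d (b d^j) = b d^(j+1) + der b d^j. *)
Definition dmulp q : {poly K} := q * 'X + map_poly (@der K) q.

(* Coefficients of (sum_i p`_i d^i) o q. *)
Definition opmulp p q : {poly K} :=
  \sum_(i < size p) p`_i *: iter i dmulp q.

Fact dmulpD : {morph dmulp : p q / p + q}.
Proof. by move=> p q; rewrite /dmulp mulrDl raddfD addrACA. Qed.

Fact dmulp0 : dmulp 0 = 0.
Proof. by rewrite /dmulp mul0r raddf0 addr0. Qed.

Fact dmulpZ a q : dmulp (a *: q) = a *: dmulp q + der a *: q.
Proof.
rewrite /dmulp scalerDr scalerAl -addrA; congr (_ + _).
by apply/polyP=> i; rewrite !(coef_map, coefD, coefZ) /= derM addrC.
Qed.

Fact iter_dmulpD i : {morph iter i dmulp : p q / p + q}.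
Proof. by elim: i => // i IHi p q; rewrite !iterS IHi dmulpD. Qed.

Fact opmulpE n p q : (size p <= n)%N ->
  opmulp p q = \sum_(i < n) p`_i *: iter i dmulp q.
Proof.
move=> le_pn; rewrite /opmulp (big_ord_widen _ (fun i => p`_i *: iter i dmulp q) le_pn).
rewrite big_mkcond; apply: eq_bigr => i _; case: ltnP => // le_pi.
by rewrite nth_default ?scale0r.
Qed.

Fact opmulpDl p q r : opmulp (p + q) r = opmulp p r + opmulp q r.
Proof.
pose n := maxn (size p) (size q).
rewrite !(@opmulpE n) ?leq_maxl ?leq_maxr ?size_polyD //.
by rewrite -big_split; apply: eq_bigr => i _; rewrite coefD scalerDl.
Qed.

Fact opmulpDr p q r : opmulp p (q + r) = opmulp p q + opmulp p r.
Proof.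
by rewrite -big_split; apply: eq_bigr => i _; rewrite iter_dmulpD scalerDr.
Qed.

Fact opmul0p q : opmulp 0 q = 0.
Proof. by rewrite /opmulp size_poly0 big_ord0. Qed.

Fact opmulpZl a p q : opmulp (a *: p) q = a *: opmulp p q.
Proof.
rewrite (@opmulpE (size p)) ?size_scale_leq // scaler_sumr.
by apply: eq_bigr => i _; rewrite coefZ scalerA.
Qed.

Fact opmulXnp i q : opmulp 'X^i q = iter i dmulp q.
Proof.
rewrite /opmulp size_polyXn big_ord_recr /= coefXn eqxx scale1r big1 ?add0r //.
by move=> j _; rewrite coefXn (ltn_eqF (ltn_ord j)) scale0r.
Qed.

Fact poly_additive_ind (P : {poly K} -> Prop) :
  P 0 -> (forall p q, P p -> P q -> P (p + q)) ->
  (forall a i, P (a *: 'X^i)) -> forall p, P p.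
Proof.
move=> P0 PD PX p; rewrite -[p]coefK poly_def.
by apply: (big_ind P) => // i _; apply: PX.
Qed.

Fact dmulpXn i : dmulp 'X^i = 'X^(i.+1).
Proof.
rewrite /dmulp -exprSr; apply/polyP=> j.
rewrite coefD coef_map /= -[RHS]addr0 coefXn; congr (_ + _).
by rewrite coefXn; case: (j == i); [exact: der1 | exact: raddf0].
Qed.

Fact opmul_dmulp p q : opmulp (dmulp p) q = dmulp (opmulp p q).
Proof.
elim/poly_additive_ind: p => [|p1 p2 IH1 IH2|a i].
- by rewrite dmulp0 opmul0p dmulp0.
- by rewrite dmulpD opmulpDl IH1 IH2 (opmulpDl p1) dmulpD.
by rewrite dmulpZ dmulpXn opmulpDl !opmulpZl !opmulXnp dmulpZ -iterS.
Qed.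

Fact opmulpA : associative opmulp.
Proof.
move=> p q r; elim/poly_additive_ind: p => [|p1 p2 IH1 IH2|a i].
- by rewrite !opmul0p.
- by rewrite !opmulpDl IH1 IH2.
rewrite !opmulpZl !opmulXnp; congr (_ *: _).
by elim: i => //= i ->; rewrite opmul_dmulp.
Qed.

Fact opmul1p : left_id 1 opmulp.
Proof. by move=> q; rewrite -(expr0 'X) opmulXnp. Qed.

Fact opmulp1 : right_id 1 opmulp.
Proof.
move=> p; rewrite -[RHS]coefK poly_def; apply: eq_bigr => i _.
congr (_ *: _); case: i => i _ /=.
by elim: i => //= i ->; rewrite dmulpXn.
Qed.

Definition diffop_zero : diffop K := DiffOp 0.
Definition diffop_one : diffop K := DiffOp 1.
Definition diffop_opp A : diffop K := DiffOp (- coefs A).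
Definition diffop_add A B : diffop K := DiffOp (coefs A + coefs B).
Definition diffop_mul A B : diffop K := DiffOp (opmulp (coefs A) (coefs B)).

Fact diffop_addA : associative diffop_add.
Proof. by move=> A B C; rewrite /diffop_add addrA. Qed.
Fact diffop_addC : commutative diffop_add.
Proof. by move=> A B; rewrite /diffop_add addrC. Qed.
Fact diffop_add0 : left_id diffop_zero diffop_add.
Proof. by case=> p; rewrite /diffop_add add0r. Qed.
Fact diffop_addN : left_inverse diffop_zero diffop_opp diffop_add.
Proof. by move=> A; rewrite /diffop_add addNr. Qed.
Fact diffop_mulA : associative diffop_mul.
Proof. by move=> A B C; rewrite /diffop_mul opmulpA. Qed.
Fact diffop_mul1l : left_id diffop_one diffop_mul.
Proof. by case=> p; rewrite /diffop_mul opmul1p. Qed.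
Fact diffop_mul1r : right_id diffop_one diffop_mul.
Proof. by case=> p; rewrite /diffop_mul opmulp1. Qed.
Fact diffop_mulDl : left_distributive diffop_mul diffop_add.
Proof. by move=> A B C; rewrite /diffop_mul opmulpDl. Qed.
Fact diffop_mulDr : right_distributive diffop_mul diffop_add.
Proof. by move=> A B C; rewrite /diffop_mul opmulpDr. Qed.
Fact diffop_one_neq0 : diffop_one != diffop_zero.
Proof. by rewrite -val_eqE /= oner_neq0. Qed.

HB.instance Definition _ := GRing.isNzRing.Build (diffop K)
  diffop_addA diffop_addC diffop_add0 diffop_addN
  diffop_mulA diffop_mul1l diffop_mul1r diffop_mulDl diffop_mulDr
  diffop_one_neq0.

Definition diffopC (a : K) : diffop K := DiffOp a%:P.

Definition diffopX : diffop K := DiffOp 'X.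

Lemma diffopXC a :
  diffopX * diffopC a = diffopC a * diffopX + diffopC (der a).
Proof.
apply: val_inj => /=; rewrite -(expr1 'X) opmulXnp /= -[a%:P]mulr1.
by rewrite mul_polyC opmulpZl opmul1p dmulpZ -(expr0 'X) dmulpXn alg_polyC.
Qed.

Fact diffopC_is_zmod_morphism : zmod_morphism diffopC.
Proof. by move=> a b; apply: val_inj; rewrite /= polyCB. Qed.

Fact diffopC_is_monoid_morphism : monoid_morphism diffopC.
Proof.
split=> [|a b]; apply: val_inj => //=.
by rewrite -[a%:P]mulr1 mul_polyC opmulpZl opmul1p polyCM mul_polyC.
Qed.

HB.instance Definition _ :=
  GRing.isZmodMorphism.Build K (diffop K) diffopC diffopC_is_zmod_morphism.
HB.instance Definition _ :=
  GRing.isMonoidMorphism.Build K (diffop K) diffopC diffopC_is_monoid_morphism.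

Lemma diffopE A :
  A = \sum_(i < size (coefs A)) diffopC (coefs A)`_i * diffopX ^+ i.
Proof.
have coefs_sum n (F : 'I_n -> diffop K) :
    coefs (\sum_i F i) = \sum_i coefs (F i).
  by apply: (big_morph (@coefs K)).
have coefsXn i : coefs (diffopX ^+ i) = 'X^i.
  elim: i => // i IHi; rewrite exprS /= IHi -(expr1 'X) opmulXnp /=.
  exact: dmulpXn.
apply: val_inj => /=; rewrite coefs_sum -[LHS]coefK poly_def.
apply: eq_bigr => i _ /=; rewrite coefsXn -[_%:P]mulr1 mul_polyC.
by rewrite opmulpZl opmul1p.
Qed.

(* The zero operator also gets order 0. *)
Definition diffop_order A : nat := (size (coefs A)).-1.

(* C[d], for C the field of constants. *)
Definition const_diffop : {pred diffop K} :=
  [pred A | coefs A \is a polyOver (@is_const K)].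

(* g(P, Q), with 'X_0 and 'X_1 sent to P and Q; [mmap] puts the powers of P
   to the left of those of Q, which is immaterial when P and Q commute. *)
Definition eval2 A B (g : {mpoly (constants K)[2]}) : diffop K :=
  mmap (diffopC \o val) (fun i : 'I_2 => if i == 0 then A else B) g.

Definition BC A B : {pred {mpoly (constants K)[2]}} :=
  [pred g | eval2 A B g == 0].

End DiffopRing.

(* Main.v *)
Require Import Defs.
From mathcomp Require Import all_boot all_order all_algebra.
From mathcomp Require Import mpoly.

Set Implicit Arguments.
Unset Strict Implicit.
Unset Printing Implicit Defensive.

Import GRing.Theory.
Local Open Scope ring_scope.

(** The map g |-> g(P, Q) is a ring homomorphism, because P and Q commute with
    each other and with the constants, and its target is a ring without zero
    divisors; the kernel of such a homomorphism is a prime ideal, proper since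
    1 is sent to 1.

    The absence of zero divisors is read off leading coefficients: moving d
    past a coefficient only produces terms of lower order, so the leading
    coefficient of a product is the product of the leading coefficients
    ([lead_coef_opmulp]).  Multiplicativity of the evaluation is
    [mmap_commM], for any family of pairwise commuting elements that commute
    with the images of the scalars. *)

Section CommutingEvaluation.
Variables (n : nat) (R : comNzRingType) (S : nzRingType).
Variables (f : {rmorphism R -> S}) (h : 'I_n -> S).
Hypothesis comm_hh : forall i j, GRing.comm (h i) (h j).
Hypothesis comm_fh : forall a i, GRing.comm (f a) (h i).

Lemma comm_mmap1 x m : (forall i, GRing.comm x (h i)) ->
  GRing.comm x (mmap1 h m).
Proof. by move=> comm_xh; apply: commr_prod => i _; apply: commrX. Qed.

(** Differential operators are far from central, so the h i are only required
    to commute with one another: regrouping the factors of the two monomials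
    never moves a power of some h i past anything but powers of other h j. *)
Lemma mmap1_commM m1 m2 : mmap1 h (m1 + m2) = mmap1 h m1 * mmap1 h m2.
Proof.
rewrite /mmap1.
(* The induction carries along that the partial product x of the powers given
   by m1 commutes with every h j, so that the next power of m2 can cross it. *)
pose inv x y z := (forall j, GRing.comm (h j) x) /\ z = x * y.
suff [] : inv (\prod_(i < n) h i ^+ m1 i) (\prod_(i < n) h i ^+ m2 i)
              (\prod_(i < n) h i ^+ (m1 + m2)%MM i) by [].
apply: (big_rec3 inv) => [|i x y z _ [comm_x ->]].
  by split=> [j|]; [exact: commr1 | rewrite mulr1].
split=> [j|]; first by apply: commrM (comm_x j); apply: commrX.
have comm_xi : GRing.comm x (h i ^+ m2 i).
  by apply: commrX; apply: commr_sym.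
by rewrite mnmDE exprD -!mulrA (mulrA x) comm_xi !mulrA.
Qed.

Lemma mmap_commM : {morph mmap f h : p q / p * q}.
Proof.
move=> p q; elim/mpolyind: p => [|c m p _ _ IHp].
  by rewrite !(mul0r, mmap0).
rewrite mulrDl !mmapD mulrDl {}IHp; congr (_ + _).
elim/mpolyind: q => [|d k q _ _ IHq].
  by rewrite !(mulr0, mmap0).
rewrite mulrDr !mmapD mulrDr {}IHq; congr (_ + _).
rewrite -scalerAl -scalerAr scalerA -mpolyXD !mmapZ !mmapX mmap1_commM rmorphM.
have comm_dm : GRing.comm (f d) (mmap1 h m) by apply: comm_mmap1.
by rewrite -!mulrA (mulrA (mmap1 h m)) -comm_dm !mulrA.
Qed.

End CommutingEvaluation.

Section Domain.
Variable K : diffFieldType.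
Implicit Types (p q : {poly K}) (A B : diffop K).

(** In degree i + j >= i + deg q, the derivatives of the coefficients of q
    contribute nothing to d^i o q, which there looks like 'X^i * q. *)
Lemma coef_iter_dmulp q i j : (size q <= j.+1)%N ->
  (iter i (@dmulp K) q)`_(i + j) = q`_j.
Proof.
elim: i j => //= i IHi j le_qj.
rewrite /dmulp coefD coefMX coef_map /= IHi // addSnnS IHi ?(leqW le_qj) //.
by rewrite [q`_j.+1]nth_default // raddf0 addr0.
Qed.

Lemma lead_coef_opmulp p q :
  (opmulp p q)`_((size p).-1 + (size q).-1) = lead_coef p * lead_coef q.
Proof.
have [->|p_neq0] := eqVneq p 0.
  by rewrite opmul0p lead_coef0 mul0r coef0.
have [n def_n] : exists n, size p = n.+1.
  by exists (size p).-1; rewrite prednK // size_poly_gt0.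
rewrite /opmulp coef_sum lead_coefE def_n big_ord_recr /= coefZ.
rewrite coef_iter_dmulp ?leqSpred // -lead_coefE big1 ?add0r // => i _.
(* A term of order i < n is read in degree i + (deg q + (n - i)), beyond the
   degree of q. *)
have lt_in := ltn_ord i.
have -> : (n + (size q).-1 = i + ((n - i) + (size q).-1))%N.
  by rewrite addnA subnKC // ltnW.
have lt_q : (size q <= (n - i) + (size q).-1)%N.
  by rewrite (leq_trans (leqSpred _)) // -add1n leq_add2r subn_gt0.
by rewrite coefZ coef_iter_dmulp ?(leqW lt_q) // [q`__]nth_default // mulr0.
Qed.

Lemma diffop_mul_eq0 A B : (A * B == 0) = (A == 0) || (B == 0).
Proof.
apply/idP/orP => [|[] /eqP->]; rewrite ?mul0r ?mulr0 //.
move=> /eqP /(congr1 (@coefs K)) /= /polyP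
  /(_ ((size (coefs A)).-1 + (size (coefs B)).-1)%N).
rewrite lead_coef_opmulp coef0 => /eqP.
by rewrite mulf_eq0 !lead_coef_eq0 => /orP.
Qed.

Lemma diffopC_const_comm (c : constants K) A :
  GRing.comm (diffopC (val c)) A.
Proof.
have comm_X : GRing.comm (diffopC (val c)) (diffopX K).
  by rewrite /GRing.comm diffopXC (eqP (valP c)) rmorph0 addr0.
rewrite (diffopE A); apply: commr_sum => i _; apply: commrM.
  by rewrite /GRing.comm -!rmorphM mulrC.
exact: commrX.
Qed.

Lemma eval2M A B : A * B = B * A -> {morph eval2 A B : g k / g * k}.
Proof.
move=> commAB; apply: mmap_commM => [i j|c i]; last exact: diffopC_const_comm.
by do 2!case: ifP => _.
Qed.

End Domain.

Theorem lemma3p2 (Sigma : diffFieldType)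
    (closedC : GRing.closed_field_axiom (constants Sigma))
    (charC : [pchar (constants Sigma)] =i pred0)
    (P Q : diffop Sigma)
    (P_nonconst : P \notin @const_diffop Sigma)
    (Q_nonconst : Q \notin @const_diffop Sigma)
    (PQ_comm : P * Q = Q * P)
    (P_order : (0 < diffop_order P)%N)
    (Q_order : (0 < diffop_order Q)%N) :
  idealr_closed (BC P Q) /\ prime_idealr_closed (BC P Q).
Proof.
have evalM := eval2M PQ_comm.
split=> [|g k]; last by rewrite !inE evalM diffop_mul_eq0.
split=> [||a g k]; rewrite !inE.
- by rewrite /eval2 mmap0.
- by rewrite -mpolyC1 /eval2 mmapC /= rmorph1 oner_neq0.
move=> /eqP g0 /eqP k0.
by rewrite {1}/eval2 mmapD -!/(eval2 P Q _) evalM g0 k0 mulr0 addr0.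
Qed.
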